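(* Let $\pi\in\mathfrak{S}_n$ be an indecomposable permutation, let $G=G_\pi$ be its permutation graph, and let $s\in[n]$ be a distinguished vertex (the sink). For a spanning tree $T$ of $G$, rooted at $s$, define the configuration $c(T)=(c_1(T),\ldots,c_n(T))$ by $$c_i(T):=\lambda_i(T)+\mu_i(T)+\nu_i(T).$$ Then the map $\phi_{TC}:T\mapsto c(T)$ is a bijection from the set of spanning trees of $G$ to the set $\mathrm{Rec}_s(G)$ of recurrent configurations of the Abelian sandpile model on $G$ with sink $s$. Moreover, for every spanning tree $T$ of $G$, $$\mathrm{level}(c(T))=\sum_{i=1}^n\left(\tfrac12\mu_i(T)+\nu_i(T)\right),$$ and the canonical toppling of $c(T)$ is $T^{(0)},T^{(1)},T^{(2)},\ldots$ (the vertices of $T$ grouped by height, i.e. its breadth-first search).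
   Context: For $\pi=\pi_1\cdots\pi_n\in\mathfrak{S}_n$, the permutation graph $G_\pi$ has vertex set $[n]=\{1,\ldots,n\}$ and an edge $\{\pi_i,\pi_j\}$ whenever $i<j$ and $\pi_i>\pi_j$ (i.e. $a<b$ are adjacent iff $b$ appears before $a$ in $\pi$). $\pi$ is indecomposable if there is no $k<n$ with $\{\pi_1,\ldots,\pi_k\}=[k]$ (equivalently $G_\pi$ is connected). Abelian sandpile model on a connected graph $G$ on $[n]$ with sink $s$: a configuration is $c\in\mathbb{Z}_{\ge0}^n$; $d_i$ is the degree of $i$; vertex $i$ is stable if $c_i<d_i$, unstable otherwise; toppling an unstable vertex $i$ subtracts $d_i$ from $c_i$ and adds $1$ to $c_j$ for each neighbour $j$ of $i$. A configuration $c$ is recurrent if $c_s=d_s$, $c_i<d_i$ for all $i\ne s$, and there is an ordering $v_1=s,v_2,\ldots,v_n$ of all vertices such that starting from $c$ one can successively topple $v_1,\ldots,v_n$ (each being unstable when toppled). $\mathrm{Rec}_s(G)$ is the set of recurrent configurations. The level is $\mathrm{level}(c)=\sum_i c_i-|E(G)|$. The canonical toppling of $c\in\mathrm{Rec}_s(G)$ is the ordered set partition $P_0,P_1,\ldots,P_k$ of $[n]$ with $P_0=\{s\}$ and, for $i\ge1$, $P_i$ the set of non-sink unstable vertices obtained from $c$ after toppling all vertices of $P_0,\ldots,P_{i-1}$. For a spanning tree $T$ rooted at $s$: $h(i)$ is the distance from $i$ to $s$ in $T$; for $i\ne s$, $p(i)$ is the parent of $i$ (next vertex on the path from $i$ to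 $s$); $T^{(k)}=\{i:h(i)=k\}$, similarly $T^{(>k)}$ etc.; $N_G(i)$ is the set of neighbours of $i$ in $G$. Define $\lambda_i(T)=|N_G(i)\cap T^{(>h(i))}|$, $\mu_i(T)=|N_G(i)\cap T^{(h(i))}|$, and for $i\ne s$, $\nu_i(T)=|\{j\in N_G(i)\cap T^{(h(i)-1)}: j<p(i)\}|$, with $\nu_s(T)=0$. *)

(* Defs.v *)
From mathcomp Require Import all_boot all_order all_algebra all_fingroup.

Set Implicit Arguments.
Unset Strict Implicit.
Unset Printing Implicit Defensive.

Local Open Scope nat_scope.

(* A simple graph on a finite vertex type V is its adjacency relation G : rel V
   (symmetric and irreflexive in all uses below).  Vertices and positions
   1, ..., n are shifted to 0, ..., n-1, i.e. to elements of 'I_n. *)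

Definition nbrs (V : finType) (G : rel V) (x : V) : {set V} :=
  [set y : V | G x y].

Definition deg (V : finType) (G : rel V) (x : V) : nat := #|nbrs G x|.

Definition edges (V : finType) (G : rel V) : {set {set V}} :=
  [set [set p.1; p.2] | p : V * V & G p.1 p.2].

(* Number of edges of a shortest walk from x to y; #|V| if there is none. *)
Definition dist (V : finType) (e : rel V) (x y : V) : nat :=
  find (fun k => [exists p : k.-tuple V, path e x p && (last x p == y)])
       (iota 0 #|V|).

Definition perm_graph (n : nat) (pi : 'S_n) : rel 'I_n :=
  fun a b => [exists i : 'I_n, exists j : 'I_n,
    [&& i < j, pi j < pi i & [set a; b] == [set pi i; pi j]]].

(* The initial segment of k elements; used both for positions and for values. *)
Definition initseg (n k : nat) : {set 'I_n} := [set i : 'I_n | i < k].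

Definition indecomposable (n : nat) (pi : 'S_n) : Prop :=
  forall k, 0 < k < n -> pi @: initseg n k <> initseg n k.

(* A subgraph containing all vertices is given by its set of edges. *)
Definition tree_adj (V : finType) (T : {set {set V}}) : rel V :=
  fun x y => [set x; y] \in T.

Definition spanning_tree (V : finType) (G : rel V) (T : {set {set V}}) : Prop :=
  [/\ T \subset edges G,
      forall x y : V, connect (tree_adj T) x y
    & forall p : seq V, 2 < size p -> ~~ ucycleb (tree_adj T) p].

Definition config (V : finType) := {ffun V -> nat}.

Definition unstable (V : finType) (G : rel V) (c : config V) (x : V) : bool :=
  deg G x <= c x.

(* The truncated subtraction is exact when x is unstable. *)
Definition topple (V : finType) (G : rel V) (c : config V) (x : V) : config V :=
  [ffun y => if y == x then c y - deg G x else c y + G x y].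

Fixpoint legal_toppling (V : finType) (G : rel V) (c : config V) (v : seq V)
    : bool :=
  if v is x :: v' then unstable G c x && legal_toppling G (topple G c x) v'
  else true.

Definition recurrent (V : finType) (G : rel V) (s : V) (c : config V) : Prop :=
  [/\ c s = deg G s,
      forall x, x != s -> c x < deg G x
    & exists w : seq V,
        perm_eq (s :: w) (enum V) /\ legal_toppling G c (s :: w)].

Definition level (V : finType) (G : rel V) (c : config V) : int :=
  ((\sum_(x : V) c x)%N%:Z - #|edges G|%:Z)%R.

Definition topple_set (V : finType) (G : rel V) (c : config V) (A : {set V})
    : config V :=
  foldl (topple G) c (enum A).

Definition ordered_set_partition (V : finType) (P : seq {set V}) : bool :=
  uniq P && partition [set A in P] [set: V].

(* These conditions determine P: each block is computed from the previous ones,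
   and the sequence stops exactly when all vertices are covered. *)
Definition is_canonical_toppling (V : finType) (G : rel V) (s : V)
    (c : config V) (P : seq {set V}) : Prop :=
  [/\ ordered_set_partition P,
      nth set0 P 0 = [set s]
    & forall i, 0 < i < size P ->
        nth set0 P i =
        [set x | (x != s) && unstable G (foldl (topple_set G) c (take i P)) x]].

Definition height (V : finType) (s : V) (T : {set {set V}}) (x : V) : nat :=
  dist (tree_adj T) x s.

(* The vertex following x on the simple path from x to s in T;
   by convention s itself when x = s. *)
Definition parent (V : finType) (s : V) (T : {set {set V}}) (x : V) : V :=
  odflt x [pick y | [exists k : 'I_#|V|, exists q : k.-tuple V,
    [&& path (tree_adj T) x (y :: q), uniq [:: x, y & q] & last y q == s]]].

Definition tree_level (V : finType) (s : V) (T : {set {set V}}) (k : nat)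
    : {set V} :=
  [set x | height s T x == k].

Definition tree_above (V : finType) (s : V) (T : {set {set V}}) (k : nat)
    : {set V} :=
  [set x | k < height s T x].

Definition tree_levels (V : finType) (s : V) (T : {set {set V}})
    : seq {set V} :=
  mkseq (tree_level s T) (\max_(x : V) height s T x).+1.

Definition lambda (V : finType) (G : rel V) (s : V) (T : {set {set V}}) (i : V)
    : nat :=
  #|nbrs G i :&: tree_above s T (height s T i)|.

Definition mu (V : finType) (G : rel V) (s : V) (T : {set {set V}}) (i : V)
    : nat :=
  #|nbrs G i :&: tree_level s T (height s T i)|.

Definition nu (n : nat) (G : rel 'I_n) (s : 'I_n) (T : {set {set 'I_n}})
    (i : 'I_n) : nat :=
  if i == s then 0
  else #|[set j in nbrs G i :&: tree_level s T (height s T i - 1)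
           | j < parent s T i]|.

Definition tree_config (n : nat) (G : rel 'I_n) (s : 'I_n)
    (T : {set {set 'I_n}}) : config 'I_n :=
  [ffun i => lambda G s T i + mu G s T i + nu G s T i].

(* Main.v *)
Require Import Defs.
From mathcomp Require Import all_boot all_order all_algebra all_fingroup.
From mathcomp Require Import classical_sets functions.
From mathcomp Require Import zify lra.

(* A spanning tree amounts to a height function and a parent function, and a
   recurrent configuration to the time at which each vertex is toppled in its
   canonical toppling.  A vertex x of height k > 0 in T has
   deg x = lambda + mu + #(neighbours of height < k), so c(T) becomes unstable at x
   once the levels below k are toppled, and not earlier because nu is smaller than
   the number of neighbours at height k - 1: heights are toppling times.
   Conversely c determines the toppling times, and then nu, the rank of the
   parent among the neighbours toppled just before x, determines the parent. *)

Set Implicit Arguments.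
Unset Strict Implicit.
Unset Printing Implicit Defensive.

Import GRing.Theory.

Local Open Scope nat_scope.

(** * Graph distance, and the encoding of rooted trees by heights and parents *)

Section Graphs.

Variable V : finType.
Implicit Types (G e : rel V) (T : {set {set V}}) (h : V -> nat) (p : V -> V).

Lemma set2_inj (x y z w : V) :
  [set x; y] = [set z; w] -> (x = z /\ y = w) \/ (x = w /\ y = z).
Proof.
move=> E.
have: y \in [set z; w] by rewrite -E set22.
have: x \in [set z; w] by rewrite -E set21.
have: w \in [set x; y] by rewrite E set22.
have: z \in [set x; y] by rewrite E set21.
rewrite !inE; do 4 (case/orP => /eqP ?); subst; auto.
Qed.

Lemma mem_edges G x y :
  symmetric G -> ([set x; y] \in edges G) = G x y.
Proof.
move=> Gsym; apply/imsetP/idP => [[[a b] /=]|Gxy]; last first.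
  by exists (x, y); rewrite ?inE.
by rewrite inE /= => Gab /set2_inj[[-> ->]|[-> ->]] //; rewrite Gsym.
Qed.

Lemma tree_adj_sym T : symmetric (tree_adj T).
Proof. by move=> x y; rewrite /tree_adj finset.setUC. Qed.

Lemma dist_le e x (q : seq V) : path e x q -> dist e x (last x q) <= size q.
Proof.
move=> eq; rewrite /dist leqNgt; apply/negP => lt_q.
have lt_qV : size q < #|V|.
  by apply: leq_trans lt_q _; rewrite -[X in _ <= X](size_iota 0) find_size.
have /existsP[] := before_find 0 lt_q.
by rewrite nth_iota // add0n; exists (in_tuple q); rewrite /= eq eqxx.
Qed.

Lemma distP e x y : connect e x y ->
  exists q, [/\ path e x q, last x q = y & size q = dist e x y].
Proof.
move=> /connectP[q0 /shortenP[q eq uq _] ->].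
set P := fun k => [exists q' : k.-tuple V, path e x q' && (last x q' == last x q)].
(* The shortened path is simple, so it has fewer than [#|V|] edges and its length lies in the range
   searched by [dist]. *)
have hasP : has P (iota 0 #|V|).
  apply/hasP; exists (size q); last first.
    by apply/existsP; exists (in_tuple q); rewrite eq eqxx.
  rewrite mem_iota /= add0n.
  by rewrite -[(size q).+1]/(size (x :: q)) -(card_uniqP uq) max_card.
have /existsP[q' /andP[eq' /eqP lq']] := nth_find 0 hasP.
exists q'; split=> //; rewrite size_tuple -/(dist _ _ _).
by move: hasP; rewrite has_find size_iota => ?; rewrite nth_iota.
Qed.

Lemma dist_eq e x y k :
    (exists q, [/\ path e x q, last x q = y & size q = k]) ->
    (forall q, path e x q -> last x q = y -> k <= size q) ->
  dist e x y = k.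
Proof.
move=> [q [eq lq <-]] min_q; apply/eqP; rewrite eqn_leq -{1}lq dist_le //=.
have /distP[q' [eq' lq' <-]] : connect e x y by apply/connectP; exists q.
exact: min_q.
Qed.

(** The vertex [y] is the second one on a shortest walk: a shorter walk from [y] would shorten the
    one from [x]. *)
Lemma dist_pred e x s : connect e x s -> x != s ->
  exists2 y, e x y & dist e x s = (dist e y s).+1.
Proof.
move=> /distP[[|y q] [/= eq lq dq]]; first by rewrite lq eqxx.
move: eq => /andP[exy eq] _; exists y => //.
have le_y : dist e y s <= size q by rewrite -lq dist_le.
apply/eqP; rewrite eqn_leq -{2}dq ltnS le_y andbT.
have /distP[q' [eq' lq' <-]] : connect e y s by apply/connectP; exists q.
by rewrite -lq' -[last y q']/(last x (y :: q')) dist_le //= exy.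
Qed.

Lemma distxx e x : dist e x x = 0.
Proof. by apply: dist_eq => //; exists [::]. Qed.

(** Data from which a spanning tree rooted at [s] can be rebuilt. The value [p s] is left free, and
    [h] may exceed the distance in [G]. *)
Definition height_parent G (s : V) h p : Prop :=
  h s = 0 /\ forall x, x != s -> G x (p x) /\ h x = (h (p x)).+1.

Definition parent_tree (s : V) p : {set {set V}} :=
  [set [set x; p x] | x in [set~ s]].

Lemma parent_tree_adj s p x y : tree_adj (parent_tree s p) x y ->
  (x != s /\ y = p x) \/ (y != s /\ x = p y).
Proof.
by move=> /imsetP[z]; rewrite !inE => zs /set2_inj[[-> ->]|[-> ->]]; auto.
Qed.

Lemma adj_parent s p x : x != s -> tree_adj (parent_tree s p) x (p x).
Proof. by move=> xs; apply/imsetP; exists x; rewrite ?inE. Qed.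

(** * The tree built from a height and a parent function *)

Section ParentTree.

Variables (G : rel V) (s : V) (h : V -> nat) (p : V -> V).
Hypotheses (Gsym : symmetric G) (hp : height_parent G s h p).
Let T := parent_tree s p.

Lemma height_parent_eq0 x : (h x == 0) = (x == s).
Proof.
case: hp => hs hx; apply/idP/eqP => [|-> //]; last by rewrite hs.
by have [//|/hx[_ ->]] := eqVneq x s.
Qed.

Lemma parent_tree_walk x :
  exists q, [/\ path (tree_adj T) x q, last x q = s, size q = h x & uniq (x :: q)].
Proof.
(* The induction also records that all later vertices are lower than [x]; this makes the walk along
   parents repetition-free. *)
suff [q [Tq lq sq /andP[_ uq]]] : exists q, [/\ path (tree_adj T) x q, last x q = s,
    size q = h x & all (fun y => h y < h x) q && uniq (x :: q)] by exists q.
move Dk: (h x) => k; elim: k x Dk => [|k IH] x Dk.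
  by move/eqP: Dk; rewrite height_parent_eq0 => /eqP ->; exists [::].
have xs : x != s by rewrite -height_parent_eq0 Dk.
have [_ /(_ x xs)[_]] := hp; rewrite Dk => -[Dpx].
have [q [Tq lq sq /andP[hq uq]]] := IH _ (esym Dpx).
have lt_q : all (fun y => h y < k.+1) (p x :: q).
  by rewrite /= -Dpx leqnn; apply: sub_all hq => y /ltnW.
exists (p x :: q); rewrite [path _ _ _]/= Tq adj_parent // lt_q /= sq lq; split=> //.
rewrite -[_ && uniq q]/(uniq (p x :: q)) uq andbT.
by apply/negP => /(allP lt_q); rewrite Dk ltnn.
Qed.

(** The walk along parents has length [h x], and no walk to [s] is shorter because [h] changes by
    exactly one along each tree edge. *)
Lemma height_parent_tree x : height s T x = h x.
Proof.
apply: dist_eq; first by have [q []] := parent_tree_walk x; exists q.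
move=> q; elim: q x => [|y q IH] x /=; first by case: hp => hs _ _ ->; rewrite hs.
move=> /andP[Txy Tq] /(IH _ Tq) le_yq.
case: hp => _ hx; case: (parent_tree_adj Txy) => [[xs Dy]|[ys Dx]].
  by have [_ ->] := hx x xs; rewrite -Dy.
by have [_] := hx y ys; rewrite -Dx; lia.
Qed.

Lemma parent_tree_connect x y : connect (tree_adj T) x y.
Proof.
have xs z : connect (tree_adj T) z s.
  by have [q [Tq lq _ _]] := parent_tree_walk z; apply/connectP; exists q.
have /connect_trans -> // := xs x.
by rewrite (sym_connect_sym (@tree_adj_sym T)).
Qed.

(* Neighbours of a vertex of maximal height on a cycle coincide: both are its
   parent. *)
Lemma parent_tree_acyclic (q : seq V) :
  2 < size q -> ~~ ucycleb (tree_adj T) q.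
Proof.
move=> q2; apply/negP => /andP[cq uq].
have [x0 x0q] : exists x, x \in q.
  by case: q q2 {cq uq} => // x; exists x; rewrite inE eqxx.
have [x xq max_x] := @arg_maxnP _ x0 (mem q) h x0q.
have is_parent y : tree_adj T x y -> y \in q -> y = p x.
  move=> /parent_tree_adj[[_ ->]//|[ys Dx]] /max_x.
  by have [_ /(_ y ys)[_ ->]] := hp; rewrite -Dx /= ltnn.
have nx : next q x = p x.
  by apply: is_parent; rewrite ?mem_next // next_cycle.
have px : prev q x = p x.
  by apply: is_parent; rewrite ?mem_prev // tree_adj_sym prev_cycle.
(* Two steps forward along the cycle return to [x], which is impossible in a repetition-free cycle
   of length at least three. *)
have : next q (next q x) = x by rewrite nx -px next_prev.
have [i q' Dq] := rot_to (xq : x \in q).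
rewrite -(next_rot i uq (next q x)) -(next_rot i uq x) Dq.
move: q2 uq; rewrite -(size_rot i) -(rot_uniq i) Dq {nx px Dq}.
case: q' => [|a [|b q']] //= _; rewrite !inE eqxx.
move=> /andP[/norP[xa /norP[xb _]] _].
by rewrite eq_sym (negbTE xa) eqxx => bx; rewrite bx eqxx in xb.
Qed.

Lemma parent_tree_spanning : spanning_tree G T.
Proof.
split; [|exact: parent_tree_connect|exact: parent_tree_acyclic].
apply/fintype.subsetP => E /imsetP[x]; rewrite !inE => xs ->.
by rewrite mem_edges //; have [_ /(_ x xs)[]] := hp.
Qed.

(* A simple path that descends one step can never turn back upwards. *)
Lemma parent_tree_descend x y q :
    y != s -> p y = x -> path (tree_adj T) y q -> uniq [:: x, y & q] ->
  last y q != s.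
Proof.
elim: q x y => //= z q IH x y ys py /andP[Tyz Tq] /andP[xyzq uyzq].
case: (parent_tree_adj Tyz) => [[_ zx]|[zs Dy]]; last exact: (IH y).
by move: xyzq; rewrite zx py !inE eqxx orbT.
Qed.

(** A simple path to [s] cannot begin with an edge to a child, by [parent_tree_descend], so its
    second vertex is [p x]; the walk along parents shows that such a path exists. *)
Lemma parent_parent_tree x : x != s -> parent s T x = p x.
Proof.
move=> xs; rewrite /parent; case: pickP => [y /=|/(_ (p x)) /negbT/negP[]].
  move=> /existsP[k] /existsP[q] /and3P[/= /andP[Txy Tq] uq /eqP lq].
  case: (parent_tree_adj Txy) => [[]//|[ys Dx]].
  by have := parent_tree_descend ys (esym Dx) Tq uq; rewrite lq eqxx.
have [q [Tq lq sq uq]] := parent_tree_walk x.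
case: q Tq lq sq uq => [|y q] /= => [_ /eqP|]; first by rewrite (negbTE xs).
move=> Txyq /eqP lq _ uq.
have -> : p x = y.
  move: (Txyq) => /andP[Txy Tq].
  case: (parent_tree_adj Txy) => [[]//|[ys Dx]].
  by have := parent_tree_descend ys (esym Dx) Tq uq; rewrite lq.
have ltqV : size q < #|V|.
  apply: leq_trans (max_card (mem (y :: q))).
  by move: uq => /andP[_ uq]; rewrite (card_uniqP _).
apply/existsP; exists (Ordinal ltqV); apply/existsP; exists (in_tuple q).
exact/and3P.
Qed.

End ParentTree.

(* The breadth-first tree inside [T] is all of [T]: an edge outside it would
   close a cycle. *)
Lemma spanning_tree_parent G s T :
    symmetric G -> irreflexive G -> spanning_tree G T ->
  height_parent G s (height s T) (parent s T) /\ parent_tree s (parent s T) = T.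
Proof.
move=> Gsym Girr [TG Tconn Tacyc].
(* This parent is chosen by height rather than by simple paths; it is identified with [parent s T]
   once [T] is known to be its parent tree. *)
pose p x := odflt x [pick y | tree_adj T x y && (height s T x == (height s T y).+1)].
have pP x : x != s -> tree_adj T x (p x) /\ height s T x = (height s T (p x)).+1.
  move=> xs; rewrite /p; case: pickP => [y /andP[? /eqP]|] //=.
  have [y Txy Dx] := dist_pred (Tconn x s) xs.
  by move=> /(_ y); rewrite Txy /height Dx eqxx.
have TGxy x y : tree_adj T x y -> G x y.
  by move=> /(fintype.subsetP TG); rewrite mem_edges.
have hp : height_parent G s (height s T) p.
  by split=> [|x /pP[/TGxy]]; first exact: distxx.
have subT : subrel (tree_adj (parent_tree s p)) (tree_adj T).
  by move=> x y /parent_tree_adj[[/pP[Tx _] ->]|[/pP[Ty _] ->]]; rewrite // tree_adj_sym.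
have DT : T = parent_tree s p.
  apply/eqP; rewrite finset.eqEsubset; apply/andP; split; last first.
    by apply/fintype.subsetP => E /imsetP[x]; rewrite !inE => /pP[Tx _] ->.
  apply/fintype.subsetP => E TE; have /(fintype.subsetP TG)/imsetP[[u v]] := TE.
  rewrite inE /= => Guv DE; rewrite {}DE in TE *.
  have [q0] := connectP (parent_tree_connect hp u v).
  case/shortenP=> q Tq uq _ {q0} Dv.
  (* Length zero would make the edge a loop, length one places it in the parent tree, and a longer
     path together with the edge is a cycle of [T]. *)
  case: q => [|y [|z q]] /= in Tq uq Dv.
  - by rewrite Dv Girr in Guv.
  - by rewrite Dv; case/andP: Tq.
  have /negP[] := Tacyc [:: u, y, z & q] isT; apply/andP; split=> //=.
  rewrite rcons_path -Dv.
  case/and3P: Tq => /subT -> /subT -> /(sub_path subT) -> /=.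
  by rewrite tree_adj_sym.
have Dp x : x != s -> parent s T x = p x.
  by rewrite DT; exact: parent_parent_tree hp _.
split; last by rewrite {2}DT; apply: eq_in_imset => x; rewrite !inE => /Dp ->.
by case: hp => hs hx; split=> // x xs; rewrite Dp //; exact: hx.
Qed.

End Graphs.

(** * Legal topplings in the sandpile model *)

Section Sandpile.

Variables (V : finType) (G : rel V).
Hypotheses (Gsym : symmetric G) (Girr : irreflexive G).
Implicit Types (c : config V) (s x y : V) (v : seq V) (h : V -> nat).

(** Counts of neighbours become sums of booleans, so that identities between them can be checked one
    neighbour at a time. *)
Lemma card_nbrs (P : pred V) x :
  #|[set y in nbrs G x | P y]| = \sum_(y | G x y) P y.
Proof.
rewrite -sum1_card big_mkcond [RHS]big_mkcond; apply: eq_bigr => y _.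
by rewrite !inE; case: (G x y); case: (P y).
Qed.

Lemma degE x : deg G x = \sum_(y | G x y) 1.
Proof. by rewrite sum1dep_card. Qed.

Lemma count_nbrs x v : uniq v -> count (G x) v = \sum_(y | G x y) (y \in v).
Proof.
move=> uv; rewrite -sum1_count big_mkcond big_uniq //=.
rewrite big_mkcond [RHS]big_mkcond; apply: eq_bigr => y _.
by case: (y \in v); case: (G x y).
Qed.

Lemma legal_cat c v w :
  legal_toppling G c (v ++ w) =
  legal_toppling G c v && legal_toppling G (foldl (topple G) c v) w.
Proof. by elim: v c => //= x v IH c; rewrite IH andbA. Qed.

(** Conservation of grains at [x]. The grains lost stand on the left to avoid truncated subtraction;
    legality makes each subtraction exact. *)
Lemma foldl_topple c v x : legal_toppling G c v ->
  foldl (topple G) c v x + count_mem x v * deg G x = c x + count (G x) v.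
Proof.
elim: v c => [|y v IH] c /=; first by rewrite mul0n !addn0.
move=> /andP[unst /IH]; rewrite ffunE mulnDl addnCA => ->; rewrite addnA.
case: (eqVneq y x) => [<-|_] in unst *; last by rewrite mul0n add0n Gsym addnA.
by rewrite Girr mul1n subnKC.
Qed.

(** Toppling other vertices only adds grains, so each vertex is still unstable when its turn
    comes. *)
Lemma legal_uniq c v :
  uniq v -> (forall x, x \in v -> deg G x <= c x) -> legal_toppling G c v.
Proof.
elim: v c => //= y v IH c /andP[yv uv] unst.
rewrite /unstable unst ?mem_head //=; apply: IH => // x xv; rewrite ffunE.
have /negbTE-> : x != y by apply: contraNneq yv => <-.
by apply: leq_trans (leq_addr _ _); apply: unst; rewrite inE xv orbT.
Qed.

Lemma foldl_topple_set c (P : seq {set V}) :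
  foldl (topple_set G) c P = foldl (topple G) c (flatten [seq enum A | A : {set V} <- P]).
Proof. by elim: P c => //= A P IH c; rewrite IH foldl_cat. Qed.

(** * Toppling level by level, and toppling times *)

Definition level_seq h k := flatten [seq enum [set x | h x == j] | j <- iota 0 k].

Lemma level_seqS h k :
  level_seq h k.+1 = level_seq h k ++ enum [set x | h x == k].
Proof. by rewrite /level_seq -addn1 iotaD map_cat flatten_cat /= cats0. Qed.

Lemma mem_level_seq h k x : (x \in level_seq h k) = (h x < k).
Proof.
elim: k => [|k IH]; first by rewrite ltn0.
by rewrite level_seqS mem_cat IH mem_enum inE [RHS]ltnS [RHS]leq_eqVlt orbC.
Qed.

Lemma level_seq_uniq h k : uniq (level_seq h k).
Proof.
elim: k => // k IH; rewrite level_seqS cat_uniq IH enum_uniq andbT /=.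
by apply/hasPn => x; rewrite mem_enum inE /= mem_level_seq => /eqP ->; rewrite ltnn.
Qed.

(** The number of grains [x] has received once every vertex of time below [k] has toppled. *)
Definition low h x k := \sum_(y | G x y) (h y < k).

Lemma low0 h x : low h x 0 = 0.
Proof. by apply: big1. Qed.

Lemma low_mono h x k l : k <= l -> low h x k <= low h x l.
Proof. by move=> kl; apply: leq_sum => y _; case: ltnP => // /leq_trans ->. Qed.

Lemma low_le_deg h x k : low h x k <= deg G x.
Proof. by rewrite degE; apply: leq_sum => y _; case: (_ < _). Qed.

(* [h] is the function recording at which step of the canonical toppling of [c]
   each vertex topples. *)
Definition toppling_time (s : V) c h : Prop :=
  [/\ c s = deg G s, forall x, (h x == 0) = (x == s)
    & forall x, x != s -> c x + low h x (h x).-1 < deg G x <= c x + low h x (h x)].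

Lemma toppling_time_lt s c h x : toppling_time s c h -> x != s -> c x < deg G x.
Proof.
by move=> [_ _ ch] /ch /andP[lt_c _]; exact: leq_ltn_trans (leq_addr _ _) lt_c.
Qed.

Lemma toppling_time_legal s c h k :
  toppling_time s c h -> legal_toppling G c (level_seq h k).
Proof.
move=> [cs h0 ch]; elim: k => // k IH; rewrite level_seqS legal_cat IH /=.
apply: legal_uniq => [|x]; first exact: enum_uniq.
rewrite mem_enum inE => /eqP hx.
(* A vertex at level [k] has not toppled yet, so it has only gained grains. *)
have := foldl_topple x IH; rewrite count_uniq_mem ?level_seq_uniq //.
rewrite mem_level_seq hx ltnn mul0n addn0 count_nbrs ?level_seq_uniq // => ->.
under eq_bigr do rewrite mem_level_seq; rewrite -hx -/(low h x (h x)).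
have [->|/ch /andP[]//] := eqVneq x s.
by rewrite cs leq_addr.
Qed.

Lemma foldl_topple_level s c h k x : toppling_time s c h ->
  foldl (topple G) c (level_seq h k) x + (h x < k) * deg G x = c x + low h x k.
Proof.
move=> /(toppling_time_legal k) /foldl_topple - /(_ x).
rewrite count_uniq_mem ?level_seq_uniq // mem_level_seq => ->.
rewrite count_nbrs ?level_seq_uniq //.
by congr addn; apply: eq_bigr => y _; rewrite mem_level_seq.
Qed.

Lemma level0_set s c h : toppling_time s c h -> [set x | h x == 0] = [set s].
Proof. by move=> [_ h0 _]; apply/setP => x; rewrite !inE h0. Qed.

Lemma toppling_time_recurrent s c h : toppling_time s c h -> recurrent G s c.
Proof.
move=> ch; split; [by case: ch|by move=> x; apply: toppling_time_lt ch|].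
set m := \max_x h x.
exists (flatten [seq enum [set x | h x == j] | j <- iota 1 m]).
(* Level [0] is [[set s]], so the list of all levels starts with the sink, as recurrence demands. *)
have <- : level_seq h m.+1 = s :: flatten [seq enum [set x | h x == j] | j <- iota 1 m].
  by rewrite /level_seq /= (level0_set ch) enum_set1.
split; last exact: toppling_time_legal ch.
apply: uniq_perm; [exact: level_seq_uniq|exact: enum_uniq|move=> x].
by rewrite mem_level_seq mem_enum ltnS leq_bigmax.
Qed.

(** The sets of vertices of time at most [k] are determined by [c], by induction on [k]: membership
    at [k.+1] is an inequality that involves only the set at [k]. *)
Lemma toppling_time_uniq s c h h' :
  toppling_time s c h -> toppling_time s c h' -> h =1 h'.
Proof.
have step h1 k x : toppling_time s c h1 -> x != s ->
    (h1 x <= k.+1) = (deg G x <= c x + low h1 x k.+1).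
  move=> [_ _ ch] /ch /andP[lt_d le_d]; apply/idP/idP => [le_h|].
    by apply: leq_trans le_d _; rewrite leq_add2l low_mono.
  apply: contraTT; rewrite -!ltnNge => lt_h.
  by apply: leq_ltn_trans lt_d; rewrite leq_add2l low_mono //; lia.
move=> ch ch'; have eq_le k x : (h x <= k) = (h' x <= k).
  elim: k x => [|k IH] x.
    by case: ch ch' => [_ h0 _] [_ h0' _]; rewrite !leqn0 h0 h0'.
  have [->|xs] := eqVneq x s.
    case: ch ch' => [_ h0 _] [_ h0' _].
    by have := h0 s; have := h0' s; rewrite eqxx => /eqP -> /eqP ->.
  rewrite !step //; congr (_ <= _ + _); apply: eq_bigr => y _.
  by rewrite !ltnS IH.
by move=> x; apply/eqP; rewrite eqn_leq -eq_le leqnn eq_le leqnn.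
Qed.

(** The second hypothesis excludes gaps between the values of [h], so that all blocks are nonempty,
    as a partition requires. *)
Lemma toppling_time_canonical s c h :
    toppling_time s c h -> (forall x, x != s -> exists y, h x = (h y).+1) ->
  is_canonical_toppling G s c
    (mkseq (fun k => [set x | h x == k]) (\max_x h x).+1).
Proof.
move=> ch h_pred; set m := \max_x h x; set L := fun k => _.
have lev_ne k : k <= m -> exists x, h x = k.
  move=> le_km; have [x Dx] : exists x, h x = m.
    by have [|x] := @eq_bigmax _ h; [apply/card_gt0P; exists s | exists x].
  rewrite -(subKn le_km); elim: (m - k) => [|j [y Dy]]; first by exists x; rewrite subn0.
  have [ys|/h_pred[z Dz]] := eqVneq y s; last by exists z; lia.
  exists y; case: ch => _ /(_ s) h0 _; rewrite eqxx in h0.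
  by move: Dy; rewrite ys; lia.
have memL A : (A \in mkseq L m.+1) -> exists2 k, k <= m & A = L k.
  by move=> /mapP[k]; rewrite mem_iota add0n ltnS => /= ? ->; exists k.
have memLh x : L (h x) \in mkseq L m.+1.
  by apply: map_f; rewrite mem_iota ltnS leq_bigmax.
split.
- apply/andP; split.
    rewrite map_inj_in_uniq ?iota_uniq // => i j; rewrite mem_iota add0n ltnS => /=.
    move=> /lev_ne[x Dx] _ /setP/(_ x); rewrite !inE Dx eqxx.
    by move=> /esym/eqP.
  apply/and3P; split.
  + apply/eqP/setP => x; rewrite inE; apply/bigcupP.
    by exists (L (h x)); rewrite inE.
  + apply/finset.trivIsetP => A B; rewrite !inE => /memL[i _ ->] /memL[j _ ->] ij.
    rewrite -setI_eq0; apply/eqP/setP => x; rewrite !inE.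
    by apply/negP => /andP[/eqP hi /eqP hj]; rewrite -hi -hj eqxx in ij.
  + rewrite inE; apply/negP => /memL[k /lev_ne[x Dx] /setP/(_ x)].
    by rewrite !inE Dx eqxx.
- by rewrite nth_mkseq // /L (level0_set ch).
- move=> i; rewrite size_mkseq => /andP[i0 im]; rewrite nth_mkseq //.
  rewrite foldl_topple_set -map_take take_iota.
  have -> : minn i m.+1 = i by lia.
  rewrite -map_comp -/(level_seq h i).
  apply/setP => x; rewrite !inE; have := foldl_topple_level i x ch.
  set c' := foldl _ _ _; rewrite /unstable => Dc'.
  have [xs|xs] /= := eqVneq x s.
    have : h x == 0 by case: ch => _ -> _; rewrite xs.
    lia.
  have lt_c := toppling_time_lt ch xs.
  have [_ _ /(_ x xs)/andP[lt_d le_d]] := ch.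
  have le_low := low_le_deg h x i.
  (* Below level [i], [x] has lost [deg G x] and regained at most that, so it is stable; above, the
     strict bound at [(h x).-1] keeps it stable; at level [i] it is unstable. *)
  case: (ltngtP (h x) i) => hxi in Dc' *.
  + by apply/esym/negbTE; lia.
  + have le_i : i <= (h x).-1 by lia.
    have := low_mono h x le_i.
    by move=> ?; apply/esym/negbTE; lia.
  + by apply/esym; rewrite hxi in le_d *; lia.
Qed.

(** The set [B k] collects the vertices toppled by step [k] when everything possible topples in
    parallel, and [h x] is the first step whose set contains [x]. The legal ordering ensures that
    every vertex is reached. *)
Lemma recurrent_toppling_time s c :
  recurrent G s c -> exists h, toppling_time s c h.
Proof.
move=> [cs c_lt [w [perm_v legal_v]]].
pose B := fix B k := if k is k'.+1
  then B k' :|: [set x | deg G x <= c x + \sum_(y | G x y) (y \in B k')] else [set s].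
have B_mono k l x : k <= l -> x \in B k -> x \in B l.
  move=> /subnKC <-; elim: (l - k) => [|j IH]; first by rewrite addn0.
  by move=> /IH; rewrite addnS /= !inE => ->.
have uniq_v : uniq (s :: w) by rewrite (perm_uniq perm_v) enum_uniq.
(* Parallel toppling is never slower than the given ordering: the vertices preceding the [i.+1]-st
   one already lie in [B i]. *)
have v_in_B i : i < size (s :: w) -> nth s (s :: w) i \in B i.
  elim/ltn_ind: i => -[|i] IH lt_i; first by rewrite inE.
  set x := nth _ _ _; have := legal_v.
  rewrite -{1}(cat_take_drop i.+1 (s :: w)) legal_cat => /andP[leg].
  rewrite (drop_nth s) // -/x [legal_toppling _ _ (_ :: _)]/= => /andP[unst _].
  rewrite inE; apply/orP; right; rewrite inE.
  apply: (leq_trans (unst : deg G x <= _)).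
  have u_take : uniq (take i.+1 (s :: w)) by rewrite take_uniq.
  have x_take : x \notin take i.+1 (s :: w).
    move: uniq_v; rewrite -{1}(cat_take_drop i.+1 (s :: w)) cat_uniq.
    by rewrite (drop_nth s) // => /and3P[_ /norP[]].
  have := foldl_topple x leg; rewrite (count_memPn x_take) mul0n addn0 => ->.
  rewrite count_nbrs // leq_add2l; apply: leq_sum => y _.
  have [/(nthP s)[j]|//] := boolP (y \in take _ _).
  rewrite size_takel; last exact: ltnW.
  move=> lt_ji; rewrite nth_take // => <-.
  suff -> : nth s (s :: w) j \in B i by [].
  by apply: (B_mono j) => //; apply: IH => //; exact: ltn_trans lt_ji lt_i.
have B_ex x : exists k, x \in B k.
  exists (index x (s :: w)); rewrite -{1}(@nth_index _ s x (s :: w)).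
    by rewrite v_in_B // index_mem (perm_mem perm_v) mem_enum.
  by rewrite (perm_mem perm_v) mem_enum.
pose h x := ex_minn (B_ex x).
have hP x k : (h x <= k) = (x \in B k).
  rewrite /h; case: ex_minnP => j xj min_j; apply/idP/idP; last exact: min_j.
  by move=> /B_mono; apply.
have lowB x k : low h x k.+1 = \sum_(y | G x y) (y \in B k).
  by apply: eq_bigr => y _; rewrite ltnS hP.
exists h; split=> // [x|x xs]; first by rewrite -leqn0 hP inE.
move Dk: (h x) => k; case: k Dk => [|k] Dk.
  by have := hP x 0; rewrite Dk /= inE (negbTE xs).
apply/andP; split; last first.
  have := hP x k.+1; rewrite Dk leqnn /= inE -hP Dk ltnn inE -lowB.
  by move/esym.
(* At time one the strict bound is the stability of [c] away from the sink; later it is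
   non-membership in the previous set. *)
case: k Dk => [|k] Dk; first by rewrite low0 addn0 c_lt.
have := hP x k.+1; rewrite Dk ltnn lowB /= ltnNge.
by move/esym/negbT; rewrite !inE => /norP[].
Qed.

Lemma sum_nbrs_swap (f : V -> V -> nat) :
  \sum_x \sum_(y | G x y) f x y = \sum_x \sum_(y | G x y) f y x.
Proof.
rewrite (exchange_big_dep xpredT) //=; apply: eq_bigr => x _.
by apply: eq_bigl => y; rewrite Gsym.
Qed.

End Sandpile.

(** * Ranks of elements in a set of ordinals *)

Lemma exists_rank n (A : {set 'I_n}) k : k < #|A| ->
  exists2 x, x \in A & #|[set y in A | y < x]| = k.
Proof.
elim: k A => [|k IH] A.
  move=> /card_gt0P[x0 x0A].
  have [x xA min_x] := @arg_minnP _ x0 (mem A) (@nat_of_ord n) x0A.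
  exists x => //; apply/eqP; rewrite cards_eq0; apply/eqP/setP => y.
  by rewrite !inE; apply/negP => /andP[/min_x]; rewrite /= leqNgt => /negP.
move=> ltkA; have /card_gt0P[x0 x0A] := leq_trans (ltn0Sn k) (ltnW ltkA).
have [m mA0 min_m] := @arg_minnP _ x0 (mem A) (@nat_of_ord n) x0A.
have mA : m \in A := mA0.
(* Putting the minimum [m] back raises the rank of every other element by one. *)
have [|x] := IH (A :\ m); first by move: ltkA; rewrite (cardsD1 m) mA.
rewrite !inE => /andP[xm xA] Dk; exists x => //.
have lt_mx : m < x by rewrite ltn_neqAle min_m // andbT eq_sym.
rewrite (cardsD1 m) !inE mA lt_mx -Dk add1n; congr _.+1.
by apply: eq_card => y; rewrite !inE andbA.
Qed.

(** Rank is strictly increasing, since the smaller element is counted for the larger one but not for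
    itself. This is how [nu] identifies the parent. *)
Lemma rank_inj n (A : {set 'I_n}) x y : x \in A -> y \in A ->
  #|[set z in A | z < x]| = #|[set z in A | z < y]| -> x = y.
Proof.
have lt_rank u v : u \in A -> u < v ->
    #|[set z in A | z < u]| < #|[set z in A | z < v]|.
  move=> uA uv; apply: proper_card; apply/properP; split.
    by apply/fintype.subsetP => z; rewrite !inE => /andP[-> /ltn_trans->].
  by exists u; rewrite !inE ?uA ?uv ?ltnn.
move=> xA yA E; apply/val_inj; case: (ltngtP x y) => // [/(lt_rank _ _ xA)|/(lt_rank _ _ yA)].
  by rewrite E ltnn.
by rewrite E ltnn.
Qed.

(** * The configuration of a spanning tree, its level and its bijectivity *)

Section TreeConfig.

Variables (n : nat) (G : rel 'I_n) (s : 'I_n).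
Hypotheses (Gsym : symmetric G) (Girr : irreflexive G).
Implicit Types (T : {set {set 'I_n}}) (c : config 'I_n) (x y : 'I_n).

Lemma lambdaE T x :
  lambda G s T x = \sum_(y | G x y) (height s T x < height s T y).
Proof. by rewrite -card_nbrs; apply: eq_card => y; rewrite !inE. Qed.

Lemma muE T x :
  mu G s T x = \sum_(y | G x y) (height s T y == height s T x).
Proof. by rewrite -card_nbrs; apply: eq_card => y; rewrite !inE. Qed.

Lemma deg_split T x :
  deg G x = lambda G s T x + mu G s T x + low G (height s T) x (height s T x).
Proof.
rewrite degE lambdaE muE -!big_split; apply: eq_bigr => y _ /=.
by case: ltngtP.
Qed.

(** Orienting each edge from its smaller to its larger end counts it once; the reverse orientation
    provides the second copy. *)
Lemma card_edges : 2 * #|edges G| = \sum_x deg G x.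
Proof.
have -> : #|edges G| = \sum_x \sum_(y | G x y) (x < y).
  pose E := [set p : 'I_n * 'I_n | G p.1 p.2 && (p.1 < p.2)].
  have -> : edges G = [set [set p.1; p.2] | p in E].
    apply/setP => e; apply/imsetP/imsetP => -[[x y]]; rewrite !inE /=.
      move=> Gxy ->; case: (ltngtP x y) => [xy|yx|/val_inj xy].
      - by exists (x, y); rewrite // inE Gxy.
      - by exists (y, x); rewrite ?inE /= ?yx 1?Gsym ?Gxy // finset.setUC.
      - by rewrite xy Girr in Gxy.
    by move=> /andP[Gxy _] ->; exists (x, y); rewrite ?inE.
  rewrite card_in_imset => [|[x y] [z w]]; last first.
    rewrite !inE /= => /andP[_ xy] /andP[_ zw] /set2_inj[[-> ->]//|[xw yz]].
    by move: xy; rewrite xw yz ltnNge ltnW.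
  rewrite pair_big_dep -sum1_card big_mkcond [RHS]big_mkcond /=.
  by apply: eq_bigr => -[x y] _; rewrite inE /=; case: (G x y); case: (_ < _).
rewrite mul2n -addnn {2}(sum_nbrs_swap Gsym) -big_split; apply: eq_bigr => x _.
rewrite degE -big_split; apply: eq_bigr => y Gxy /=.
by case: (ltngtP x y) => // /val_inj xy; rewrite xy Girr in Gxy.
Qed.

(* Edges between different levels are counted once by lambda, those inside a
   level twice by mu. *)
Lemma card_edges_levels T :
  2 * #|edges G| = 2 * (\sum_x lambda G s T x) + \sum_x mu G s T x.
Proof.
rewrite card_edges (eq_bigr _ (fun x _ => deg_split T x)) !big_split /=.
(* Seen from its other end, an edge to a lower neighbour is an edge to a higher one, so this sum is
   again that of [lambda]. *)
rewrite [\sum_x low _ _ _ _](sum_nbrs_swap Gsym).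
by rewrite -(eq_bigr _ (fun x _ => lambdaE T x)); lia.
Qed.

(** The candidates for the parent of [x]; meaningful only for positive [h x], because the
    predecessor of [0] is [0]. *)
Definition prev_level (h : 'I_n -> nat) x : {set 'I_n} :=
  [set y in nbrs G x | h y == (h x).-1].

Lemma low_prev_level h x : 0 < h x ->
  low G h x (h x) = low G h x (h x).-1 + #|prev_level h x|.
Proof.
move=> hx; rewrite card_nbrs -big_split; apply: eq_bigr => y _ /=; lia.
Qed.

Lemma nuE T x : x != s ->
  nu G s T x = #|[set y in prev_level (height s T) x | y < parent s T x]|.
Proof.
by rewrite /nu => /negbTE ->; apply: eq_card => y; rewrite !inE subn1.
Qed.

(** The level formula, doubled and freed of subtraction so that it can be stated in [nat]. *)
Lemma tree_config_level T :
  2 * \sum_x tree_config G s T x =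
  2 * #|edges G| + \sum_x mu G s T x + 2 * \sum_x nu G s T x.
Proof.
under eq_bigr do rewrite ffunE.
rewrite !big_split /= (card_edges_levels T).
by rewrite !mulnDr -(addnA (2 * _) (\sum_x mu _ _ _ x)) addnn -mul2n.
Qed.

Section SpanningTree.

Variable T : {set {set 'I_n}}.
Hypothesis spT : spanning_tree G T.
Let hp := (spanning_tree_parent s Gsym Girr spT).1.

Lemma parent_prev_level x : x != s -> parent s T x \in prev_level (height s T) x.
Proof. by case: hp => _ hx /hx[Gx Dx]; rewrite !inE Gx Dx eqxx. Qed.

Lemma tree_config_time : toppling_time G s (tree_config G s T) (height s T).
Proof.
split=> [|x|x xs]; last 1 first.
- have [_ /(_ x xs)[_ Dx]] := hp.
  rewrite ffunE (deg_split T x) [X in _ < X]addnC.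
  have h0 : 0 < height s T x by rewrite Dx.
  rewrite (low_prev_level h0); apply/andP; split; last by lia.
  (* Strict, because the parent of [x] is in the previous level but is not smaller than itself. *)
  suff : nu G s T x < #|prev_level (height s T) x| by lia.
  rewrite nuE //; apply: proper_card; apply/properP; split.
    by apply/fintype.subsetP => y; rewrite !inE => /andP[].
  by exists (parent s T x); rewrite ?parent_prev_level // !inE ltnn andbF.
- rewrite ffunE (deg_split T s) /nu eqxx.
  by have [-> _] := hp; rewrite low0.
- exact: height_parent_eq0 hp x.
Qed.

Lemma tree_config_canonical :
  is_canonical_toppling G s (tree_config G s T) (tree_levels s T).
Proof.
apply: toppling_time_canonical tree_config_time _ => // x xs.
by exists (parent s T x); case: hp => _ /(_ x xs)[].
Qed.

End SpanningTree.

(** Both height functions are toppling times of one configuration, hence equal. Cancelling [lambda]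
    and [mu] then leaves two parents of equal rank in the same set. *)
Lemma tree_config_inj T T' : spanning_tree G T -> spanning_tree G T' ->
  tree_config G s T = tree_config G s T' -> T = T'.
Proof.
move=> spT spT' E.
have Dh : height s T =1 height s T'.
  apply: (toppling_time_uniq (tree_config_time spT)).
  by rewrite E; exact: tree_config_time.
have Dp x : x != s -> parent s T x = parent s T' x.
  move=> xs; have DA : prev_level (height s T) x = prev_level (height s T') x.
    by apply/setP => y; rewrite !inE !Dh.
  apply: (rank_inj (parent_prev_level spT xs)).
    by rewrite DA parent_prev_level.
  rewrite -(nuE T xs) DA -(nuE T' xs); move/ffunP/(_ x): E; rewrite !ffunE.
  have -> : lambda G s T x = lambda G s T' x.
    by rewrite !lambdaE; apply: eq_bigr => y _; rewrite !Dh.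
  have -> : mu G s T x = mu G s T' x.
    by rewrite !muE; apply: eq_bigr => y _; rewrite !Dh.
  by move/addnI.
have [_ <-] := spanning_tree_parent s Gsym Girr spT.
have [_ <-] := spanning_tree_parent s Gsym Girr spT'.
by apply: eq_in_imset => x; rewrite !inE => /Dp ->.
Qed.

Lemma tree_config_surj c : recurrent G s c ->
  exists2 T, spanning_tree G T & tree_config G s T = c.
Proof.
move=> /(recurrent_toppling_time Gsym Girr)[h [cs h0 ch]].
(* The sums [la] and [m] are the values that [lambda] and [mu] will take on a tree with heights
   [h]. *)
pose la x := \sum_(y | G x y) (h x < h y).
pose m x := \sum_(y | G x y) (h y == h x).
have Ddeg x : deg G x = la x + m x + low G h x (h x).
  by rewrite degE -!big_split; apply: eq_bigr => y _ /=; case: ltngtP.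
pose p x := odflt x [pick y in prev_level h x |
  la x + m x + #|[set z in prev_level h x | z < y]| == c x].
have pP x : x != s -> p x \in prev_level h x /\
    la x + m x + #|[set z in prev_level h x | z < p x]| = c x.
  move=> xs; rewrite /p; case: pickP => [y /andP[? /eqP]//|] /= no_y.
  have h_gt0 : 0 < h x by rewrite lt0n h0.
  have := ch x xs; rewrite Ddeg (low_prev_level h_gt0) => /andP[lt_d le_d].
  rewrite leq_add2r in le_d.
  (* The upper bound in [toppling_time] makes this difference exact and the strict one makes it
     smaller than the number of candidates, so some candidate has this rank. *)
  have /exists_rank[y yA Dy] : c x - (la x + m x) < #|prev_level h x|.
    by rewrite ltn_subLR // -(ltn_add2r (low G h x (h x).-1)) -addnA (addnC #|_|).
  by have := no_y y; rewrite yA Dy subnKC ?eqxx.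
have hp : height_parent G s h p.
  split=> [|x xs]; first by apply/eqP; rewrite h0.
  have [] := pP x xs; rewrite !inE => /andP[Gx /eqP Dx] _; split=> //.
  by rewrite Dx prednK // lt0n h0.
exists (parent_tree s p); first exact: parent_tree_spanning hp.
apply/ffunP => x; rewrite ffunE.
have Dh := height_parent_tree hp.
have -> : lambda G s (parent_tree s p) x = la x.
  by rewrite lambdaE; apply: eq_bigr => y _; rewrite !Dh.
have -> : mu G s (parent_tree s p) x = m x.
  by rewrite muE; apply: eq_bigr => y _; rewrite !Dh.
have [->|xs] := eqVneq x s.
  have/eqP hs : h s == 0 by rewrite h0.
  by rewrite cs Ddeg hs low0 /nu eqxx.
rewrite nuE // (parent_parent_tree hp xs); have [_ <-] := pP x xs.
by congr (_ + _); apply: eq_card => y; rewrite !inE !Dh.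
Qed.

End TreeConfig.

(** * Permutation graphs and the final statement *)

Lemma perm_graph_sym n (pi : 'S_n) : symmetric (perm_graph pi).
Proof.
move=> a b; apply: eq_existsb => i; apply: eq_existsb => j.
by rewrite finset.setUC.
Qed.

Lemma perm_graph_irr n (pi : 'S_n) : irreflexive (perm_graph pi).
Proof.
move=> a; apply/existsP => -[i /existsP[j /and3P[_ lt_ji /eqP E]]].
have: pi j \in [set a; a] by rewrite E set22.
have: pi i \in [set a; a] by rewrite E set21.
by rewrite !inE !orbb => /eqP Ei /eqP Ej; rewrite Ei Ej ltnn in lt_ji.
Qed.

Local Open Scope ring_scope.

Theorem theorem3p1 (n : nat) (pi : 'S_n) (s : 'I_n) (hpi : indecomposable pi) :
  let G := perm_graph pi in
  [/\ set_bij (spanning_tree G) (recurrent G s) (tree_config G s),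
      forall T, spanning_tree G T ->
        (level G (tree_config G s T))%:~R =
        \sum_(i < n) ((mu G s T i)%:R / 2%:R + (nu G s T i)%:R) :> rat
    & forall T, spanning_tree G T ->
        is_canonical_toppling G s (tree_config G s T) (tree_levels s T)].
Proof.
move=> G; have Gsym : symmetric G := @perm_graph_sym n pi.
have Girr : irreflexive G := @perm_graph_irr n pi.
split; [split| |] => [T spT|T T' /set_mem spT /set_mem spT'|c rec_c|T spT|T spT].
- exact/toppling_time_recurrent/tree_config_time.
- exact: tree_config_inj.
- by have [T spT <-] := tree_config_surj Gsym Girr rec_c; exists T.
(* The doubled identity is carried from [nat] to [rat], where halving it is linear arithmetic. *)
- have := congr1 (fun k => k%:R : rat) (tree_config_level s Gsym Girr T).
  rewrite /= !(natrD, natrM) /level rmorphB /= -!pmulrn big_split /=.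
  rewrite -mulr_suml -!natr_sum; lra.
- exact: tree_config_canonical.
Qed.
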